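(* Let $R$ be an integral domain of characteristic zero, let $d\ge 0$ be an integer, and let $(\Delta,w)$ be an $R$-weighted $d$-complex. If $(\Delta,w)$ is balanced in degree $d$ (i.e. balanced for each of its facets), then $(\Delta,w)$ is balanced.
   Context: For an integer $d\ge 0$ and a set $\mathcal{S}$, a $d$-simplex on $\mathcal{S}$ is a multiset of cardinality $d+1$ with elements in $\mathcal{S}$; a $d$-complex on $\mathcal{S}$ is a (finite) set $\Delta$ of $d$-simplices on $\mathcal{S}$. A facet of a $d$-simplex $\sigma$ ($d\ge1$) is a $(d-1)$-simplex contained in $\sigma$ as a multiset; the only facet of a $0$-simplex is the empty set; a facet of a complex is a facet of one of its simplices. For a multiset $S$, $m(i\in S)$ denotes the number of times $i$ appears in $S$. For multisets $T,S$ on $\mathcal{S}$, put $m(T\subseteq S)=\prod_{i\in\mathcal{S}}\binom{m(i\in S)}{m(i\in T)}$, which is $0$ if $T$ is not contained in $S$. An $R$-weighting on $\Delta$ is any function $w:\Delta\to R$; $(\Delta,w)$ is then called an $R$-weighted complex. A weighted $d$-complex $(\Delta,w)$ is balanced in degree $j$ if for every multiset $S$ on $\mathcal{S}$ with $|S|=j$ one has $\sum_{\sigma\in\Delta,\ S\subseteq\sigma} w(\sigma)\, m(S\subseteq\sigma)=0$. It is balanced if it is balanced in degree $j$ for each $j\in\{0,1,\ldots,d\}$. *)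

(* Defs.v *)
From HB Require Import structures.
From mathcomp Require Import all_boot all_order all_algebra finmap multiset.

Set Implicit Arguments.
Unset Strict Implicit.
Unset Printing Implicit Defensive.

Import GRing.Theory.

Local Open Scope fset_scope.
Local Open Scope mset_scope.

(* For A : {mset K}, [A i] is the multiplicity of i in A and [size A] is the
   cardinality of A counted with multiplicity. *)

Definition is_simplex (K : choiceType) (d : nat) (sigma : {mset K}) : Prop :=
  size sigma = d.+1.

Definition is_complex (K : choiceType) (d : nat) (Delta : {fset {mset K}}) :
    Prop :=
  forall sigma : {mset K}, sigma \in Delta -> is_simplex d sigma.

(* The product over all i : K reduces to the support of T, since
   'C(S i, 0) = 1. *)
Definition msubmult (K : choiceType) (T S : {mset K}) : nat :=
  \prod_(i <- finsupp T) 'C(S i, T i).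

Local Open Scope ring_scope.

Definition balanced_in_degree (K : choiceType) (R : nzRingType)
    (Delta : {fset {mset K}}) (w : Delta -> R) (j : nat) : Prop :=
  forall S : {mset K}, size S = j ->
    \sum_(sigma : Delta | S `<=` val sigma)
      w sigma * (msubmult S (val sigma))%:R = 0.

Definition balanced (K : choiceType) (R : nzRingType) (d : nat)
    (Delta : {fset {mset K}}) (w : Delta -> R) : Prop :=
  forall j : nat, (j <= d)%N -> balanced_in_degree w j.

(* Main.v *)
Require Import Defs.
From HB Require Import structures.
From mathcomp Require Import all_boot all_order all_algebra finmap multiset.

Set Implicit Arguments.
Unset Strict Implicit.

Import GRing.Theory.
Local Open Scope fset_scope.
Local Open Scope mset_scope.
Local Open Scope ring_scope.

(** Balancedness descends one degree at a time.  Fix a multiset [S] with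
    [size S = j <= d].  Enlarging [S] by one vertex [i] changes only the factor
    at [i] of [msubmult], and the absorption identity
    [k.+1 * 'C(n, k.+1) = (n - k) * 'C(n, k)] gives
      [(S i).+1 * m(S + i in sigma) = (sigma i - S i) * m(S in sigma)]
    ([mul_msubmult_cons]).  Summed over the vertices [i], the coefficients on
    the right add up to [size sigma - size S = d.+1 - j] for every simplex
    [sigma] containing [S], while both sides vanish for the others
    ([sum_msubmult_cons]).  Hence [d.+1 - j] times the balancing sum of
    [S] is a linear combination of the balancing sums of the multisets [S + i],
    which have size [j.+1].  If these vanish then so does the balancing sum of
    [S], because [d.+1 - j] is a nonzero integer and [R] is a domain of
    characteristic zero ([balanced_in_degree_pred]).  Descending induction from
    degree [d] reaches every smaller degree. *)

(** Sums over vertices range over a common finite set [V], rather than over the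
    support of each multiset, so that multiplicities in different multisets can
    be subtracted termwise and sums over vertices and over simplices can be
    exchanged. *)
Lemma sum_mset_fset (K : choiceType) (A : {mset K}) (V : {fset K}) :
  (finsupp A `<=` V)%fset -> (\sum_(i <- V) A i)%N = size A.
Proof.
move=> sAV; rewrite -sum1_size sum_mset.
rewrite -(big_fset_incl _ sAV); first by apply: eq_bigr => i _; rewrite muln1.
by move=> i _; apply: fsfun_dflt.
Qed.

Lemma size_mset1D (K : choiceType) (i : K) (S : {mset K}) :
  size (i +` S) = (size S).+1.
Proof.
by rewrite -[S in LHS]seq_mset_id -mset_cons (perm_size (perm_eq_seq_mset _)).
Qed.

Lemma msubmult_fset (K : choiceType) (T S : {mset K}) (V : {fset K}) :
  (finsupp T `<=` V)%fset -> msubmult T S = (\prod_(i <- V) 'C(S i, T i))%N.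
Proof.
move=> sTV; rewrite /msubmult; apply: big_fset_incl => // i _ iT.
by rewrite (fsfun_dflt iT) bin0.
Qed.

Lemma msubmult_eq0 (K : choiceType) (T S : {mset K}) :
  ~~ (T `<=` S) -> msubmult T S = 0%N.
Proof.
rewrite /msubset negb_forall => /existsP[i]; rewrite -ltnNge => ltST.
by rewrite /msubmult (big_fsetD1 (val i)) ?fsvalP //= bin_small.
Qed.

(** The absorption identity at the vertex [i].  No containment is assumed: when
    [sigma i < S i] the truncated difference is 0, and the left-hand side
    vanishes through its binomial coefficient at [i]. *)
Lemma mul_msubmult_cons (K : choiceType) (S sigma : {mset K}) (i : K) :
  ((S i).+1 * msubmult (i +` S) sigma = (sigma i - S i) * msubmult S sigma)%N.
Proof.
have sS1 : (finsupp S `<=` finsupp (i +` S))%fset.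
  by apply/fsubsetP => x; rewrite !msuppE => xS; apply: mset1Dr.
have iS1 : i \in finsupp (i +` S) by rewrite msuppE mset1D1.
rewrite (msubmult_fset sigma sS1) /msubmult !(big_fsetD1 i iS1) /=.
rewrite mset1DE eqxx add1n !mulnA mul_bin_left; congr (_ * _)%N.
rewrite !big_seq; apply: eq_bigr => k; rewrite !inE => /andP[/negbTE ki _].
by rewrite mset1DE ki.
Qed.

Lemma sum_msubmult_cons (K : choiceType) (S sigma : {mset K}) (V : {fset K}) :
  (finsupp sigma `<=` V)%fset ->
  (\sum_(i <- V) (S i).+1 * msubmult (i +` S) sigma
     = (size sigma - size S) * msubmult S sigma)%N.
Proof.
move=> sV; under eq_bigr do rewrite mul_msubmult_cons.
rewrite -big_distrl /=.
have [sS|/msubmult_eq0->] := boolP (S `<=` sigma); last by rewrite !muln0.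
have sSV : (finsupp S `<=` V)%fset.
  apply: fsubset_trans sV; apply/fsubsetP => x; rewrite !msuppE.
  exact: msubset_subset.
rewrite sumnB => [|i _]; last exact: (msubsetP sS).
by rewrite !sum_mset_fset.
Qed.

(** Since [msubmult] already vanishes outside containment, the side condition
    can be dropped; the range of summation then no longer depends on [S]. *)
Lemma balanced_in_degreeE (K : choiceType) (R : nzRingType)
    (Delta : {fset {mset K}}) (w : Delta -> R) (S : {mset K}) :
  \sum_(sigma : Delta | S `<=` val sigma) w sigma * (msubmult S (val sigma))%:R
  = \sum_(sigma : Delta) w sigma * (msubmult S (val sigma))%:R.
Proof.
rewrite big_mkcond; apply: eq_bigr => sigma _.
by case: ifPn => // /msubmult_eq0->; rewrite mulr0.
Qed.

(** Double counting of the pairs of a simplex [sigma] and a vertex [i] added to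
    [S].  Purity of [Delta] makes the factor [d.+1 - j] the same for every
    simplex, so that it comes out of the sum; [j <= d] makes it nonzero. *)
Lemma balanced_in_degree_pred (K : choiceType) (R : idomainType)
    (charR0 : [pchar R] =i pred0) (d j : nat)
    (Delta : {fset {mset K}}) (hDelta : is_complex d Delta) (w : Delta -> R) :
  (j <= d)%N -> balanced_in_degree w j.+1 -> balanced_in_degree w j.
Proof.
move=> le_jd hw S szS; rewrite balanced_in_degreeE; apply/eqP.
have nz : (d.+1 - j)%:R != 0 :> R.
  by rewrite ((pcharf0P R).1 charR0) subn_eq0 -ltnNge ltnS.
rewrite -(mulrI_eq0 _ (mulfI nz)); apply/eqP.
pose V := (\bigcup_(sigma <- Delta) finsupp sigma)%fset.
have sV (sigma : Delta) : (finsupp (val sigma) `<=` V)%fset.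
  by apply: bigfcup_sup => //; apply: valP.
transitivity (\sum_(i <- V) (S i).+1%:R *
    \sum_(sigma : Delta) w sigma * (msubmult (i +` S) (val sigma))%:R).
  under [RHS]eq_bigr do rewrite mulr_sumr.
  rewrite exchange_big mulr_sumr; apply: eq_bigr => sigma _ /=.
  rewrite -szS -(hDelta _ (valP sigma)) mulrCA -natrM.
  rewrite -(sum_msubmult_cons S (sV sigma)).
  rewrite natr_sum mulr_sumr; apply: eq_bigr => i _.
  by rewrite natrM mulrCA.
rewrite big1 // => i _; rewrite -balanced_in_degreeE hw ?mulr0 //.
by rewrite size_mset1D szS.
Qed.

Theorem theorem2p5 (K : choiceType) (R : idomainType)
    (charR0 : [pchar R] =i pred0) (d : nat)
    (Delta : {fset {mset K}}) (hDelta : is_complex d Delta)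
    (w : Delta -> R) (hw : balanced_in_degree w d) :
  balanced d w.
Proof.
move=> j le_jd; rewrite -(subKn le_jd).
elim: (d - j)%N => [|k IHk]; first by rewrite subn0.
(* Past [k = d] the truncated subtraction [d - k] stays at degree 0. *)
have [lt_kd|le_dk] := ltnP k d; last first.
  by move: IHk; rewrite (eqP le_dk) (eqP (leqW le_dk)).
apply: (balanced_in_degree_pred charR0 hDelta); first exact: leq_subr.
by rewrite subnSK.
Qed.
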